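(* Let $H\le F_n$ be a finitely generated subgroup and let $g\in F_n$, $g\ne 1$, be an element that depends on $H$. Let $G=\mathrm{core}_*(H)\vee\mathrm{core}_*(\langle g\rangle)$, let $L$ be the number of edges of the graph $G$, and let $d_{min}$ be the minimum possible degree for a non-trivial equation in $\mathfrak I_g$. Then there is a non-trivial equation $w\in\mathfrak I_g$ of degree $d_{min}$ such that the corresponding path $\sigma:I_l\to G$ has length $l\le 16L^2d_{min}$.
   Context: Equations. $F_n$ is the free group with basis $a_1,\dots,a_n$, and $\langle x\rangle\cong\mathbb Z$. An equation is an element $w\in H*\langle x\rangle$, uniquely expressed as a reduced word in the alphabet $\{x,x^{-1}\}\cup(H\setminus\{1\})$; its degree is the number of occurrences of $x$ and $x^{-1}$ in its cyclic reduction. $\varphi_g:H*\langle x\rangle\to F_n$ is the inclusion on $H$ and sends $x$ to $g$; $\mathfrak I_g=\ker\varphi_g$. $g$ depends on $H$ if $\mathfrak I_g\neq1$. Graphs and paths. A graph is a 1-dimensional CW complex (loops and multiple edges allowed). A combinatorial map of graphs is a continuous map sending vertices to vertices and each open edge homeomorphically onto an open edge. $I_l$ ($l\ge1$) is the unit interval subdivided into $l$ edges, with vertices $i/l$. A combinatorial path of length $l$ in a graph is a combinatorial map from $I_l$; it is reduced if it is locally injective. Core graphs. $R_n$ is the rose with one vertex and $n$ oriented edges labeled $a_1,\dots,a_n$, with $\pi_1(R_n,* )=F_n$. For $K\le F_n$, $(\mathrm{cov}(K),* )\to(R_n,* )$ is the pointed covering with fundamental group $K$; for $K\ne1$, $\mathrm{core}_*(K)$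 is the subgraph of $\mathrm{cov}(K)$ given by the union of the images of all reduced paths from the basepoint $*$ to itself. It is labeled by restricting the covering map, and $\pi_1(\mathrm{core}_*(K),* )\cong K$. The graph $G$ is obtained from the disjoint union of $\mathrm{core}_*(H)$ and $\mathrm{core}_*(\langle g\rangle)$ by identifying the basepoints to a point $*$. Let $\theta:H*\langle x\rangle\to\pi_1(G,* )$ be the isomorphism sending each element of $H$ to the corresponding class in $\mathrm{core}_*(H)$ and $x$ to the class in $\mathrm{core}_*(\langle g\rangle)$ corresponding to $g$. The path corresponding to a non-trivial equation $w$ is the unique reduced path $\sigma:I_l\to G$, $\sigma(0)=\sigma(1)=*$, in the homotopy class $\theta(w)$ (relative to endpoints). *)

(* Defs.v *)
From HB Require Import structures.
From mathcomp Require Import all_boot finmap.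
From mathcomp Require Import boolp classical_sets functions cardinality.

Set Implicit Arguments.
Unset Strict Implicit.
Unset Printing Implicit Defensive.

Local Open Scope classical_set_scope.
Local Open Scope group_scope.

(* Words over the signed alphabet A * bool: (a, true) stands for a and         *)
(* (a, false) for its formal inverse.  They serve both as group words          *)
(* (A = basis) and as edge paths (A = edges of a graph).                       *)
Section SignedWords.
Variable A : choiceType.
Implicit Types (d : A * bool) (s t : seq (A * bool)).

Definition linv d := (d.1, ~~ d.2).

Definition winv s := rev (map linv s).

Definition reduced s := sorted (fun d e => e != linv d) s.

Definition cons_red d s :=
  if s is e :: s' then if e == linv d then s' else d :: s else [:: d].

Definition reduce s := foldr cons_red [::] s.

Lemma linvK : involutive linv.
Proof. by case=> a b; rewrite /linv /= negbK. Qed.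

Lemma winvK : involutive winv.
Proof. by move=> s; rewrite /winv map_rev revK mapK //; exact: linvK. Qed.

Lemma reduced_behead d s : reduced (d :: s) -> reduced s.
Proof. by case: s => //= e s /andP[]. Qed.

Lemma cons_red_reduced d s : reduced s -> reduced (cons_red d s).
Proof.
case: s => //= e s rs; case: ifP => [_|/negbT ne]; first exact: reduced_behead rs.
by rewrite /= ne.
Qed.

Lemma foldr_cons_red s t : reduced t -> reduced (foldr cons_red t s).
Proof. by move=> rt; elim: s => //= d s; exact: cons_red_reduced. Qed.

Lemma reduce_reduced s : reduced (reduce s).
Proof. exact: foldr_cons_red. Qed.

Lemma reduce_id s : reduced s -> reduce s = s.
Proof.
elim: s => //= d s IH rs; rewrite IH ?(reduced_behead rs) //.
by case: s rs {IH} => //= e s /andP[/negPf->].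
Qed.

Lemma cons_redK d s : reduced s -> cons_red (linv d) (cons_red d s) = s.
Proof.
case: s => [|e s] rs /=; first by rewrite linvK eqxx.
case: (eqVneq e (linv d)) => [ee|ne] /=; last by rewrite linvK eqxx.
by rewrite ee in rs *; case: s rs => //= e' s /andP[/negPf->].
Qed.

Lemma foldr_cons_redE d s t : reduced s -> reduced t ->
  foldr cons_red t (cons_red d s) = cons_red d (foldr cons_red t s).
Proof.
case: s => //= e s rs rt; case: eqP => [->|//].
by rewrite -{1}(linvK d) cons_redK // foldr_cons_red.
Qed.

Lemma reduce_catr s t : reduce (s ++ reduce t) = reduce (s ++ t).
Proof. by rewrite /reduce !foldr_cat -/(reduce _) reduce_id ?reduce_reduced. Qed.

Lemma reduce_catl s t : reduce (reduce s ++ t) = reduce (s ++ t).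
Proof.
rewrite /reduce !foldr_cat -/(reduce t).
elim: s => //= d s IH.
by rewrite foldr_cons_redE ?IH // reduce_reduced.
Qed.

Lemma reduce_winvl s : reduce (winv s ++ s) = [::].
Proof.
elim: s => //= d s IH.
rewrite /winv /= rev_cons -cats1 -catA /= -reduce_catr /=.
by rewrite cons_redK ?reduce_reduced // reduce_catr.
Qed.

Lemma reduce_winvr s : reduce (s ++ winv s) = [::].
Proof. by rewrite -{1}(winvK s) reduce_winvl. Qed.

End SignedWords.

(* The free group on A: reduced words under concatenation and reduction. *)
Record free_group (A : choiceType) :=
  FreeGroup { fword :> seq (A * bool); _ : reduced fword }.

Section FreeGroupTheory.
Variable A : choiceType.

HB.instance Definition _ := [isSub for @fword A].
HB.instance Definition _ := [Choice of free_group A by <:].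
Local Notation F := (free_group A).
Implicit Types x y : F.

Definition fg_of (s : seq (A * bool)) : F := FreeGroup (reduce_reduced s).
Definition fg_one : F := fg_of [::].
Definition fg_mul x y : F := fg_of (fword x ++ fword y).
Definition fg_inv x : F := fg_of (winv (fword x)).

Lemma fg_valK x : reduce (fword x) = fword x.
Proof. by case: x => s rs; exact: reduce_id. Qed.

Lemma fg_mulA : associative fg_mul.
Proof.
by move=> x y z; apply: val_inj; rewrite /= reduce_catr reduce_catl catA.
Qed.

Lemma fg_mul1 : left_id fg_one fg_mul.
Proof. by move=> x; apply: val_inj; exact: fg_valK. Qed.

Lemma fg_mulr1 : right_id fg_one fg_mul.
Proof. by move=> x; apply: val_inj; rewrite /= cats0 fg_valK. Qed.

Lemma fg_mulV : left_inverse fg_one fg_inv fg_mul.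
Proof. by move=> x; apply: val_inj; rewrite /= reduce_catl reduce_winvl. Qed.

Lemma fg_mulrV : right_inverse fg_one fg_inv fg_mul.
Proof. by move=> x; apply: val_inj; rewrite /= reduce_catr reduce_winvr. Qed.

HB.instance Definition _ := isGroup.Build F
  fg_mulA fg_mul1 fg_mulr1 fg_mulV fg_mulrV.

Lemma fg_ofM s t : fg_of (s ++ t) = fg_of s * fg_of t.
Proof. by apply: val_inj; rewrite /= reduce_catr reduce_catl. Qed.

End FreeGroupTheory.

Notation F n := (free_group 'I_n).

Definition set_elt T (A : set T) (x : T) (Ax : x \in A) : set_type A :=
  exist _ x Ax.

Section Subgroups.
Variable G : groupType.

Definition subgroup (H : set G) := group_closed [pred x in H].

Definition generated (S : set G) : set G := smallest subgroup S.

Definition finitely_generated (H : set G) :=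
  exists s : seq G, H = generated [set` s].

End Subgroups.

(* Pointed graphs with oriented edges labeled by 'I_n, i.e. graphs with a       *)
(* combinatorial map to the rose R_n.                                           *)
Record rose_graph (n : nat) := RoseGraph {
  vertex : choiceType;
  edge : choiceType;
  src : edge -> vertex;
  dst : edge -> vertex;
  label : edge -> 'I_n;
  base : vertex }.

Arguments base {n} _.

Section Graphs.
Variable n : nat.
Implicit Types G : rose_graph n.

(* (e, true) traverses e from src e to dst e, (e, false) from dst e to src e.   *)
Definition dart G : Type := edge G * bool.
Definition tail G (d : dart G) := if d.2 then src d.1 else dst d.1.
Definition head G (d : dart G) := if d.2 then dst d.1 else src d.1.

(* A combinatorial path of length l is the sequence of the l darts it traverses *)
(* (up to reparametrization of the edges of I_l); the empty sequence is the     *)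
(* constant path.  It is locally injective iff it is [reduced].                 *)
Fixpoint is_path G (u : vertex G) (p : seq (dart G)) (v : vertex G) : Prop :=
  if p is d :: p' then tail d = u /\ is_path (head d) p' v else u = v.

(* Homotopy relative to endpoints. *)
Inductive homotopic G (u v : vertex G) : seq (dart G) -> seq (dart G) -> Prop :=
| homotopic_refl p : is_path u p v -> homotopic u v p p
| homotopic_sym p q : homotopic u v p q -> homotopic u v q p
| homotopic_trans p q r :
    homotopic u v p q -> homotopic u v q r -> homotopic u v p r
| homotopic_backtrack p d q :
    is_path u (p ++ [:: d; linv d] ++ q) v -> is_path u (p ++ q) v ->
    homotopic u v (p ++ [:: d; linv d] ++ q) (p ++ q).

(* The image of a path in F_n under the map to R_n. *)
Definition path_label G (p : seq (dart G)) : F n :=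
  fg_of [seq (label d.1, d.2) | d <- p].

(* The covering with fundamental group K: the Schreier graph, whose vertices    *)
(* are the right cosets K w, with an edge labeled i from K w to K w a_i.        *)
Definition rcosets_of (K : set (F n)) : set (set (F n)) :=
  range (fun w => [set k * w | k in K]).

Definition gen_F (i : 'I_n) : F n := fg_of [:: (i, true)].

Lemma rcosets_base K : K \in rcosets_of K.
Proof.
rewrite inE; exists 1 => //; apply/seteqP; split=> [x [k Kk <-]|x Kx].
  by rewrite mulg1.
by exists x => //; rewrite mulg1.
Qed.

Lemma rcosets_mul K (v : rcosets_of K) w :
  [set x * w | x in val v] \in rcosets_of K.
Proof.
case: v => v /= /set_mem[y _ <-]; rewrite inE; exists (y * w) => //.
by rewrite image_comp; apply: eq_imagel => k _ /=; rewrite mulgA.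
Qed.

Definition cov (K : set (F n)) : rose_graph n := {|
  vertex := rcosets_of K : choiceType;
  edge := (rcosets_of K * 'I_n)%type;
  src e := e.1;
  dst e := set_elt (rcosets_mul e.1 (gen_F e.2));
  label e := e.2;
  base := set_elt (rcosets_base K) |}.

(* [cov K] is the pointed covering of R_n with fundamental group K: it has      *)
(* exactly one outgoing and one incoming edge labeled i at each vertex, it is   *)
(* connected, and K is the set of labels of its closed paths at the base point. *)
Lemma cov_out K (v : vertex (cov K)) i :
  exists! e : edge (cov K), src e = v /\ label e = i.
Proof. by exists (v, i); split=> // -[v' i'] /= [-> ->]. Qed.

Lemma transl_mul (A : set (F n)) x y :
  [set z * y | z in [set z * x | z in A]] = [set z * (x * y) | z in A].
Proof. by rewrite image_comp; apply: eq_imagel => z _ /=; rewrite mulgA. Qed.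

Lemma transl1 (A : set (F n)) : [set z * 1 | z in A] = A.
Proof.
apply/seteqP; split=> [z [x Ax <-]|z Az]; first by rewrite mulg1.
by exists z => //; rewrite mulg1.
Qed.

Lemma cov_in K (v : vertex (cov K)) i :
  exists! e : edge (cov K), dst e = v /\ label e = i.
Proof.
exists (set_elt (rcosets_mul v (gen_F i)^-1), i); split=> [|[u j] /= [<- <-]].
  by split=> //; apply: val_inj; rewrite /= transl_mul mulVg transl1.
by congr (_, _); apply: val_inj; rewrite /= transl_mul mulgV transl1.
Qed.

Lemma gen_FV i : (gen_F i)^-1 = fg_of [:: (i, false)].
Proof. exact: val_inj. Qed.

Lemma dart_head K (d : dart (cov K)) :
  val (head d) = [set z * fg_of [:: (label d.1, d.2)] | z in val (tail d)].
Proof.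
case: d => [[v i] []] //=.
by rewrite /head /tail /= -gen_FV transl_mul mulgV transl1.
Qed.

Lemma path_label_cons G d (p : seq (dart G)) :
  path_label (d :: p) = fg_of [:: (label d.1, d.2)] * path_label p.
Proof. by rewrite -fg_ofM. Qed.

Lemma cov_path_end K (u v : vertex (cov K)) p :
  is_path u p v -> val v = [set z * path_label p | z in val u].
Proof.
elim: p u => [|d p IH] u; first by move=> /= ->; rewrite transl1.
by case=> <- /IH ->; rewrite dart_head transl_mul -path_label_cons.
Qed.

Lemma cov_lift K (u : vertex (cov K)) x :
  exists p v, is_path u p v /\ path_label p = x.
Proof.
have -> : x = fg_of (fword x) by apply: val_inj; rewrite /= fg_valK.
elim: (fword x) u => {x} [|[i b] s IH] u; first by exists [::], u.
have [d [td ld]] : exists d : dart (cov K),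
    tail d = u /\ (label d.1, d.2) = (i, b).
  case: b; first by exists ((u, i), true).
  by have [e [[eu ei] _]] := cov_in u i; exists (e, false); rewrite -ei.
have [p [v [pv lp]]] := IH (head d).
exists (d :: p), v; split=> //=.
by rewrite path_label_cons ld lp -fg_ofM.
Qed.

Lemma cov_connected K (v : vertex (cov K)) :
  exists p, is_path (base (cov K)) p v.
Proof.
have /set_mem[x _ Kx] := valP v.
have [p [u [pu px]]] := cov_lift (base (cov K)) x.
exists p; suff -> : v = u by [].
by apply: val_inj; rewrite (cov_path_end pu) px -Kx.
Qed.

Lemma cov_pi1 K x : subgroup K ->
  K x <-> exists p : seq (dart (cov K)),
    is_path (base (cov K)) p (base (cov K)) /\ path_label p = x.
Proof.
move=> sK; have K1 : K 1 by case: sK => /set_mem.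
split=> [Kx|[p [/cov_path_end pK <-]]]; last first.
  suff : [set z * path_label p | z in K] (path_label p) by rewrite -pK.
  by exists 1; rewrite ?mul1g.
have [p [u [pu px]]] := cov_lift (base (cov K)) x.
exists p; split=> //; suff {2}-> : base (cov K) = u by [].
apply: val_inj; rewrite (cov_path_end pu) px /=.
apply/seteqP; split=> [z Kz|_ [z Kz <-]].
  exists (z * x^-1); last by rewrite mulgVK.
  by have := sK.2 z x; rewrite !inE; exact.
by have := group_closedM sK; move=> /(_ z x); rewrite !inE; exact.
Qed.

(* The union of the images of all reduced paths from the base point to itself. *)
Definition core_vertices G : set (vertex G) := [set v | exists p q,
  [/\ is_path (base G) p v, is_path v q (base G) & reduced (p ++ q)]].
Definition core_edges G : set (edge G) := [set e | exists p b q,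
  is_path (base G) (p ++ (e, b) :: q) (base G) /\ reduced (p ++ (e, b) :: q)].

Arguments core_vertices : clear implicits.
Arguments core_edges : clear implicits.

Lemma core_base G : base G \in core_vertices G.
Proof. by rewrite inE; exists [::], [::]. Qed.

Lemma is_path_cat G (u v : vertex G) p q :
  is_path u (p ++ q) v <-> exists2 w, is_path u p w & is_path w q v.
Proof.
elim: p u => /= [|d p IH] u; first by split=> [?|[_ <-]//]; exists u.
split=> [[<- /IH[w pw qw]]|[w [<- pw] qw]]; first by exists w.
by split=> //; apply/IH; exists w.
Qed.

Lemma core_src G e : e \in core_edges G -> src e \in core_vertices G.
Proof.
rewrite !inE => -[p [[] [q [/is_path_cat[w pw [/= tw qw]] r]]]].
  by subst w; exists p, ((e, true) :: q).
exists (rcons p (e, false)), q; split=> //; last by rewrite cat_rcons.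
by rewrite -cats1; apply/is_path_cat; exists w.
Qed.

Lemma core_dst G e : e \in core_edges G -> dst e \in core_vertices G.
Proof.
rewrite !inE => -[p [[] [q [/is_path_cat[w pw [/= tw qw]] r]]]].
  exists (rcons p (e, true)), q; split=> //; last by rewrite cat_rcons.
  by rewrite -cats1; apply/is_path_cat; exists w.
by subst w; exists p, ((e, false) :: q).
Qed.

Definition core G : rose_graph n := {|
  vertex := core_vertices G : choiceType;
  edge := core_edges G : choiceType;
  src e := set_elt (core_src (valP e));
  dst e := set_elt (core_dst (valP e));
  label e := label (val e);
  base := set_elt (core_base G) |}.

(* The wedge of pointed graphs: the base point of G2 is replaced by that of G1. *)
Section Wedge.
Variables G1 G2 : rose_graph n.

Definition wedge_vertex : choiceType :=
  (vertex G1 + {v : vertex G2 | v != base G2})%type.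

Definition wedge_inr (v : vertex G2) : wedge_vertex :=
  oapp inr (inl (base G1)) (insub v).

Definition wedge : rose_graph n := {|
  vertex := wedge_vertex;
  edge := (edge G1 + edge G2)%type;
  src e := match e with inl e1 => inl (src e1) | inr e2 => wedge_inr (src e2) end;
  dst e := match e with inl e1 => inl (dst e1) | inr e2 => wedge_inr (dst e2) end;
  label e := match e with inl e1 => label e1 | inr e2 => label e2 end;
  base := inl (base G1) |}.

Definition wedge_pathl (p : seq (dart G1)) : seq (dart wedge) :=
  [seq (inl d.1, d.2) | d <- p].
Definition wedge_pathr (p : seq (dart G2)) : seq (dart wedge) :=
  [seq (inr d.1, d.2) | d <- p].

End Wedge.

Definition num_edges G : nat := #|` fset_set [set: edge G]|.

End Graphs.

Section Equations.
Variable n : nat.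
Implicit Types (H : set (F n)) (g : F n).

(* Letters of the words in {x, x^-1} and H: [inl true] is x, [inl false] is    *)
(* x^-1 and [inr h] is h.                                                       *)
Definition letter : Type := bool + F n.
Implicit Types (s t : letter) (w : seq letter).

Definition is_x s := if s is inl _ then true else false.

Definition compatible s t :=
  match s, t with
  | inl a, inl b => a == b
  | inr _, inr _ => false
  | _, _ => true
  end.

(* The free product H * <x>, each element being identified with its reduced     *)
(* word.                                                                        *)
Definition free_product H : set (seq letter) := [set w |
  (forall h, inr h \in w -> H h /\ h != 1) /\ sorted compatible w].

Definition eval_letter g s : F n :=
  match s with inl true => g | inl false => g^-1 | inr h => h end.

Definition phi g w : F n := \prod_(s <- w) eval_letter g s.

Definition ideal H g : set (seq letter) :=
  [set w | free_product H w /\ phi g w = 1].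

Definition depends_on H g := ideal H g <> [set [::]].

(* One step of cyclic reduction conjugates a reduced word whose last and first  *)
(* letters cancel or can be multiplied in H.                                    *)
Definition cyclic_step w :=
  if w is s :: t :: v then
    let m := belast t v in
    match s, last t v with
    | inl a, inl b => if a == b then w else m
    | inr h, inr k => if k * h == 1 then m else inr (k * h) :: m
    | _, _ => w
    end
  else w.

Definition cyclic_reduction w := iter (size w) cyclic_step w.

Definition degree w := count is_x (cyclic_reduction w).

Definition is_min_degree H g (d : nat) :=
  (exists w, [/\ ideal H g w, w <> [::] & degree w = d]) /\
  (forall w, ideal H g w -> w <> [::] -> (d <= degree w)%N).

Definition core_star (K : set (F n)) := core (cov K).

Definition core_wedge H g : rose_graph n :=
  wedge (core_star H) (core_star (generated [set g])).

(* The loops in core_*(K) corresponding to k under pi_1(core_*(K)) = K.         *)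
Definition core_loops (K : set (F n)) (k : F n) : set (seq (dart (core_star K))) :=
  [set p | is_path (base _) p (base _) /\ path_label p = k].
Arguments core_loops : clear implicits.

Section CorrespondingPath.
Variables (H : set (F n)) (g : F n).
Local Notation star := (base (core_wedge H g)).

Definition letter_loops s : set (seq (dart (core_wedge H g))) :=
  match s with
  | inl true => [set wedge_pathr _ p | p in core_loops _ g]
  | inl false => [set winv (wedge_pathr _ p) | p in core_loops _ g]
  | inr h => [set wedge_pathl _ p | p in core_loops H h]
  end.

(* theta(w), as a set of mutually homotopic closed paths at the base point.     *)
Fixpoint theta w : set (seq (dart (core_wedge H g))) :=
  if w is s :: w' then
    [set r | exists p q, [/\ letter_loops s p, theta w' q
                           & homotopic star star (p ++ q) r]]
  else [set r | homotopic star star [::] r].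

Definition corresponding_path w sigma := theta w sigma /\ reduced sigma.

End CorrespondingPath.

End Equations.

(* Main.v *)
(* Read the trivial label of a reduced loop of G as a non-crossing matching of   *)
(* its darts.  Both parts of the wedge are immersed in the rose, so a reduced    *)
(* loop can only cancel where it switches parts, which happens at most 2d times  *)
(* for an equation of degree d: these are the innermost pairs of the matching.   *)
(* If more than 2L^2 pairs are nested, two of them consist of the same darts,    *)
(* and the loop is X a Y a Z b U b V; since Z and Y U have trivial label,        *)
(* X a Z b V is a shorter reduced loop of the same label.  The degree is         *)
(* measured by the crossings of an edge of core_*(<g>) that the loop of g        *)
(* crosses in one direction only, and this number does not increase.  So in a    *)
(* loop of minimal length at most 2L^2 pairs lie above each innermost one, and   *)
(* its length is at most 8 L^2 d.                                                *)
Require Import Defs.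
From mathcomp Require Import all_boot finmap zify.
From mathcomp Require Import boolp classical_sets functions cardinality.

(* Restores [head], shadowed by the one of seq.                                  *)
Import Defs.

Set Implicit Arguments.
Unset Strict Implicit.
Unset Printing Implicit Defensive.

Local Open Scope group_scope.

(** * Words and matchings *)

(** Non-trivial equations in [ideal H g] correspond to non-empty reduced loops of [core_wedge H g]
    with trivial label, and such a loop is shortened by cutting. The degree is made visible on the
    loop itself: by [oneway_dart] the loop of [g] crosses some edge in one direction only, say [c]
    times, and by [power_loop_crossings] a loop of label [g ^+ k] or [g ^- k] crosses it at least
    [c * k] times. Hence [path_word] turns a reduced loop of trivial label with at most [c * dmin]
    crossings into an equation with at most [dmin] letters x; [word_path] goes back.

    A trivial label makes the darts of a loop a Dyck word ([lab1_dyck]). Both cores are immersed in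
    the rose, so adjacent cancelling darts of a reduced loop lie in different parts of the wedge
    ([wedge_cancel]), which happens at most [2 * dmin] times. A matched pair takes at most 2L^2
    values ([nest_size_uniq]), so a longer nested chain repeats one; [nest_dup] finds a piece to cut
    out, and [excise_path], [excise_reduced] and [excise_crossings] show that a reduced loop with no
    more crossings remains. Once no chain exceeds 2L^2, [dyck_size] bounds the length by 8 L^2
    dmin. *)

Section Words.
Variable A : choiceType.
Implicit Types (d e : A * bool) (s t u c : seq (A * bool)).

Lemma linv_neq d : linv d != d.
Proof. by case: d => a b; rewrite /linv xpair_eqE eqxx /=; case: b. Qed.

Lemma linv_eqC d e : (d == linv e) = (e == linv d).
Proof. by apply/eqP/eqP => ->; rewrite linvK. Qed.

Lemma winv_cat s t : winv (s ++ t) = winv t ++ winv s.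
Proof. by rewrite /winv map_cat rev_cat. Qed.

Lemma winv_cons d s : winv (d :: s) = rcons (winv s) (linv d).
Proof. by rewrite /winv /= rev_cons. Qed.

Lemma winv_rcons s d : winv (rcons s d) = linv d :: winv s.
Proof. by rewrite /winv map_rcons rev_rcons. Qed.

Lemma mem_winv s d : (d \in winv s) = (linv d \in s).
Proof. by rewrite mem_rev -{1}(linvK d) mem_map //; exact: inv_inj (@linvK A). Qed.

Lemma reduced_winv s : reduced (winv s) = reduced s.
Proof.
rewrite /reduced /winv rev_sorted sorted_map; apply: eq_sorted => d e /=.
by rewrite inj_eq; [rewrite eq_sym linv_eqC eq_sym | exact: inv_inj (@linvK A)].
Qed.

Lemma reduced_catP s d e t :
  reduced (s ++ d :: e :: t)
  = [&& reduced (rcons s d), e != linv d & reduced (e :: t)].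
Proof.
by rewrite /reduced; case: s => [|x s] //=; rewrite cat_path rcons_path /= andbA.
Qed.

Lemma reduced_catl s t : reduced (s ++ t) -> reduced s.
Proof. by rewrite /reduced; case: s => //= x s; rewrite cat_path => /andP[]. Qed.

Lemma reduced_catr s t : reduced (s ++ t) -> reduced t.
Proof. by elim: s => //= d s IH /reduced_behead. Qed.

Lemma fg_of_eq1 s : fg_of s = 1 <-> reduce s = [::].
Proof. by split=> [/(congr1 (@fword _))|E]; [|apply: val_inj]. Qed.

Lemma fg_of_fword (x : free_group A) : fg_of (fword x) = x.
Proof. by apply: val_inj; exact: fg_valK. Qed.

Lemma fwordK s : reduced s -> fword (fg_of s) = s.
Proof. exact: reduce_id. Qed.

Lemma fword_reduced (x : free_group A) : reduced (fword x).
Proof. by case: x. Qed.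

Lemma fg_of_linv d : fg_of [:: linv d] = (fg_of [:: d])^-1.
Proof. exact: val_inj. Qed.

Lemma fg_of_winv s : fg_of (winv s) = (fg_of s)^-1.
Proof.
by apply/esym/mulg1_eq; rewrite -fg_ofM; apply/fg_of_eq1/reduce_winvr.
Qed.

Definition wpow c k := flatten (nseq k c).

Lemma wpowS c k : wpow c k.+1 = c ++ wpow c k.
Proof. by []. Qed.

Lemma fg_of_wpow c k : fg_of (wpow c k) = fg_of c ^+ k.
Proof. by elim: k => [|k IH]; rewrite ?expg0 // wpowS fg_ofM IH expgS. Qed.

Lemma reduced_glue s c t : c <> [::] -> reduced (s ++ c) -> reduced (c ++ t) ->
  reduced (s ++ c ++ t).
Proof.
case: c => // d c _; elim: s => //= x s IH rs rt.
have := IH (reduced_behead rs) rt.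
by case: s rs {IH} => [|y s] /= /andP[-> _].
Qed.

Lemma reduced_wpow s c k : reduced (s ++ c) -> reduced (c ++ c) ->
  reduced (s ++ wpow c k).
Proof.
case: c => [|d c] rs rc.
  by rewrite /wpow; elim: k.
have rck m : reduced ((d :: c) ++ wpow (d :: c) m).
  elim: m => [|m IH]; first by rewrite cats0; exact: reduced_catl rc.
  by rewrite wpowS; exact: reduced_glue.
case: k => [|k]; [rewrite cats0; exact: reduced_catl rs|rewrite wpowS].
exact: reduced_glue.
Qed.

Lemma cyclic_decomposition s : reduced s -> s <> [::] ->
  exists u d c, s = u ++ (d :: c) ++ winv u /\ reduced ((d :: c) ++ (d :: c)).
Proof.
have [m] := ubnP (size s); elim: m s => // m IH s.
case: s => // d s sz; case: (lastP s) sz => [_ _ _|{}s e sz rs _].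
  by exists [::], d, [::]; split=> //=; rewrite eq_sym linv_neq.
have [ed|ne] := eqVneq e (linv d); last first.
  exists [::], d, (rcons s e); rewrite cats0; split; first by [].
  rewrite -[_ ++ _]/(rcons (d :: s) e ++ d :: rcons s e) cat_rcons reduced_catP.
  by rewrite rcons_cons rs linv_eqC ne.
have [u [f [c [E rc]]]] : exists u f c,
    s = u ++ (f :: c) ++ winv u /\ reduced ((f :: c) ++ (f :: c)).
  apply: IH; first by rewrite /= size_rcons in sz; lia.
    by move: rs; rewrite -cats1 => /reduced_behead/reduced_catl.
  by move=> s0; move: rs; rewrite s0 ed /= eqxx.
exists (d :: u), f, c; split; last exact: rc.
by rewrite E ed winv_cons -!cats1 /= -?catA /= -?catA. 
Qed.

Lemma last_wpow d c k x : last x (wpow (d :: c) k.+1) = last d c.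
Proof.
elim: k x => [|k IH] x; first by rewrite wpowS cats0.
by rewrite wpowS last_cat IH.
Qed.

Lemma reduced_cyclic d c :
  reduced ((d :: c) ++ (d :: c)) -> d != linv (last d c).
Proof.
by rewrite [X in X ++ _]lastI cat_rcons reduced_catP => /and3P[].
Qed.

Lemma conj_expg (G : groupType) (x y : G) k :
  (x * y * x^-1) ^+ k * x = x * y ^+ k.
Proof.
elim: k => [|k IH]; first by rewrite !expg0 mul1g mulg1.
by rewrite expgS -mulgA IH expgS !mulgA mulgVK.
Qed.

(** In the covering of the subgroup generated by s, the label condition says that the prefix ending
    in [linv d] arrives at the same vertex as [u]. For k > 0, the reduced form of s^k u is u(dc)^k,
    whose last letter would be [linv d]; that of s^-k u continues [u] by the inverse of the last
    letter of dc, whereas s continues it by [d]. Either way dc would cancel against itself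
    cyclically. For k = 0, [u] would end in [linv d], just before a [d]. *)
Lemma no_backward_prefix u d c t r k (b : bool) :
    let s := u ++ (d :: c) ++ winv u in
    reduced s -> reduced ((d :: c) ++ (d :: c)) ->
    s = rcons t (linv d) ++ r ->
  fg_of (rcons t (linv d)) = (if b then fg_of s ^+ k else fg_of s ^- k) * fg_of u ->
  False.
Proof.
move=> s rs rc E; have ne := reduced_cyclic rc.
have rt : reduced (rcons t (linv d)) by apply: (@reduced_catl _ r); rewrite -E.
have ru : reduced (u ++ (d :: c)).
  by move: rs; rewrite /s catA => /reduced_catl.
have rv : reduced (u ++ winv (d :: c)).
  by rewrite -reduced_winv winv_cat winvK; apply: (@reduced_catr u).
have rc' : reduced (winv (d :: c) ++ winv (d :: c)).
  by rewrite -winv_cat reduced_winv.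
have sE : fg_of s = fg_of u * fg_of (d :: c) * (fg_of u)^-1.
  by rewrite /s !fg_ofM fg_of_winv mulgA.
have pos : fg_of (rcons t (linv d)) = fg_of s ^+ k * fg_of u -> False.
  rewrite sE conj_expg -fg_of_wpow -fg_ofM => /(congr1 (@fword _)).
  rewrite !fwordK //; last exact: reduced_wpow.
  case: k => [|k] Ht.
    rewrite cats0 in Ht; move: ru; rewrite -Ht cat_rcons reduced_catP linvK eqxx.
    by rewrite andbF.
  move: ne; have <- := last_wpow d c k (last d u); rewrite -last_cat -Ht.
  by rewrite last_rcons linvK eqxx.
case: b => //; rewrite -expVgn sE !invgM invgK mulgA conj_expg -fg_of_winv -fg_of_wpow.
rewrite -fg_ofM => /(congr1 (@fword _)).
rewrite !fwordK //; last exact: reduced_wpow.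
case: k pos => [pos Ht|k _ Ht].
  by apply: pos; rewrite Ht cats0 expg0 mul1g.
move: E; rewrite Ht wpowS /s -!catA => /eqP; rewrite eqseq_cat // eqxx /=.
by rewrite (lastI d c) winv_rcons /= eqseq_cons (negPf ne).
Qed.

End Words.

Lemma map_wpow (A B : choiceType) (f : A * bool -> B * bool) c k :
  map f (wpow c k) = wpow (map f c) k.
Proof. by rewrite /wpow map_flatten map_nseq. Qed.

(** * Non-crossing matchings and nested chains *)

Section Nesting.
Variables (A T : choiceType) (f : T -> A * bool).
Implicit Types (s t X Y Z U V : seq T) (C : seq (T * T)).

Local Notation lab s := (fg_of [seq f x | x <- s]).

Lemma lab_cat s t : lab (s ++ t) = lab s * lab t.
Proof. by rewrite map_cat fg_ofM. Qed.

Lemma lab_cons x s : lab (x :: s) = fg_of [:: f x] * lab s.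
Proof. by rewrite -fg_ofM. Qed.

Lemma lab_pair a s b t : f b = linv (f a) -> lab s = 1 ->
  lab (a :: s ++ b :: t) = lab t.
Proof.
by move=> fb s1; rewrite lab_cons lab_cat lab_cons s1 mul1g fb fg_of_linv mulVKg.
Qed.

Inductive dyck : seq T -> Prop :=
| dyck_nil : dyck [::]
| dyck_node a s b t : f b = linv (f a) -> dyck s -> dyck t ->
    dyck (a :: s ++ b :: t).

Lemma dyck_lab s : dyck s -> lab s = 1.
Proof. by elim=> // a {}s b t fb _ s1 _ t1; rewrite lab_pair. Qed.

(** The second case strengthens the induction: the first letter of the reduction comes from a
    surviving [a] preceded only by matched letters, so a new letter that cancels it has [a] as its
    partner. *)
Lemma reduce_dyck s : 
  match reduce [seq f x | x <- s] with
  | [::] => dyck s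
  | x :: r => exists s1 a s2, [/\ s = s1 ++ a :: s2, dyck s1, f a = x
                                & reduce [seq f x | x <- s2] = r]
  end.
Proof.
have [m] := ubnP (size s); elim: m s => // m IH [|d s] /= sz.
  exact: dyck_nil.
have := IH s sz; case E: (reduce _) => [|e r].
  by move=> Ds; exists [::], d, s; split=> //; exact: dyck_nil.
move=> [s1 [a [s2 [sE Ds1 fa r2]]]] /=; case: eqP => [eE|_]; last first.
  by exists [::], d, s; split=> //; exact: dyck_nil.
have := IH s2; rewrite r2; case: r {E} r2 => [|x r] r2 H.
  rewrite sE; apply: dyck_node => //; first by rewrite fa.
  by apply: H; move: sz; rewrite sE size_cat /=; lia.
have [|s3 [a' [s4 [s2E Ds3 fa' r4]]]] := H.
  by move: sz; rewrite sE size_cat /=; lia.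
exists (d :: s1 ++ a :: s3), a', s4; split=> //; first by rewrite sE s2E /= -catA.
by apply: dyck_node => //; rewrite fa.
Qed.

Lemma lab1_dyck s : lab s = 1 -> dyck s.
Proof. by move=> /fg_of_eq1 E; have := reduce_dyck s; rewrite E. Qed.

(* Chains of nested matched pairs, outermost first. *)
Inductive nest : seq (T * T) -> seq T -> Prop :=
| nest_nil s : lab s = 1 -> nest [::] s
| nest_cons a b C X s V : f b = linv (f a) -> lab (X ++ V) = 1 -> nest C s ->
    nest ((a, b) :: C) (X ++ a :: s ++ b :: V).

Lemma nest_lab C s : nest C s -> lab s = 1.
Proof.
elim=> // a b {}C X {}s V fb XV _ s1.
by rewrite lab_cat lab_pair // -lab_cat.
Qed.

Lemma nest_matched C s a b : nest C s -> (a, b) \in C -> f b = linv (f a).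
Proof.
by elim=> // x y {}C X {}s V fb _ _ IH; rewrite inE => /predU1P[[-> ->]|/IH].
Qed.

Lemma nest_mem C s a b : nest C s -> (a, b) \in C -> exists X Z V,
  [/\ s = X ++ a :: Z ++ b :: V, lab (X ++ V) = 1 & lab Z = 1].
Proof.
elim=> // x y {}C X {}s V fb XV Cs IH; rewrite inE => /predU1P[[-> ->]|].
  by exists X, s, V; split=> //; exact: nest_lab Cs.
move=> /IH[X' [Z [V' [sE XV' Z1]]]].
exists (X ++ x :: X'), Z, (V' ++ y :: V); split=> //.
  by rewrite sE -!catA /= -!catA.
rewrite -catA cat_cons (catA X') lab_cat lab_pair //.
by rewrite -lab_cat.
Qed.

(** Equal pairs of a chain enclose one another, with [Y] and [U] between them. As [Y ++ U] and [Z]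
    have trivial label, the outer pair can enclose [Z] directly without changing the label of the
    word. *)
Lemma nest_dup C s : nest C s -> ~~ uniq C ->
  exists X a Y Z U b V,
   [/\ s = X ++ a :: (Y ++ a :: Z ++ b :: U) ++ b :: V, f b = linv (f a),
       lab (Y ++ U) = 1 & lab Z = 1].
Proof.
elim=> // x y {}C X {}s V fb XV Cs IH /=; rewrite negb_and negbK => /orP[inC|].
  have [Y [Z [U [sE YU Z1]]]] := nest_mem Cs inC.
  by exists X, x, Y, Z, U, y, V; split=> //; rewrite sE.
move=> /IH[X' [a [Y [Z [U [b [V' [sE fab YU Z1]]]]]]]].
exists (X ++ x :: X'), a, Y, Z, U, b, (V' ++ y :: V); split=> //.
by rewrite sE -!catA /= -!catA /= -!catA /= -!catA.
Qed.

Fixpoint adj (R : rel T) s :=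
  if s is a :: s' then (if s' is b :: _ then R a b : nat else 0) + adj R s' else 0%N.

Lemma adj_cat (R : rel T) s t : (adj R s + adj R t <= adj R (s ++ t))%N.
Proof.
by elim: s => //= a s IH; case: s IH => [|b s] /= IH; [exact: leq_addl | lia].
Qed.

Lemma adj_le (R R' : rel T) s :
  (forall X a b V, s = X ++ a :: b :: V -> R a b -> R' a b) ->
  (adj R s <= adj R' s)%N.
Proof.
elim: s => //= a s IH H; apply: leq_add.
  case: s H {IH} => // b s H; move: (H [::] a b s erefl).
  by case: (R a b) => // ->.
by apply: IH => X x y V sE; apply: (H (a :: X)); rewrite sE.
Qed.

Definition cancels : rel T := fun a b => f b == linv (f a).

(* Every pair of the matching lies above an innermost pair, which consists of   *)
(* two adjacent letters, and at most k pairs lie above a given one.             *)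
Lemma dyck_size s k : dyck s -> (forall C, nest C s -> (size C <= k)%N) ->
  (size s <= 2 * k * adj cancels s)%N.
Proof.
move=> Ds; elim: Ds k => // a {}s b t fb Ds IHs Dt IHt k Hk.
have s1 := dyck_lab Ds; have t1 := dyck_lab Dt.
(* The pair [(a, b)] can be put on top of any chain of [s]. *)
have Hs C : nest C s -> (size C <= k.-1)%N.
  move=> Cs; suff : nest ((a, b) :: C) ([::] ++ a :: s ++ b :: t).
    by move/Hk => /=; lia.
  exact: nest_cons.
(* The outermost pair of a chain of [t] absorbs the prefix [a s b], of trivial label, into its left
   context. *)
have Ht C : nest C t -> (size C <= k)%N.
  move=> Ct; case: Ct Hk => [//|x y {}C X t' V xy XV Ct] Hk.
  suff : nest ((x, y) :: C) ((a :: s ++ b :: X) ++ x :: t' ++ y :: V).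
    by rewrite cat_cons -catA => /Hk.
  by apply: nest_cons => //; rewrite cat_cons -catA lab_pair.
have k0 : (0 < k)%N.
  suff /Hk : nest [:: (a, b)] ([::] ++ a :: s ++ b :: t) by [].
  by apply: nest_cons => //; exact: nest_nil.
have {IHt}Ht := IHt _ Ht; have {IHs}Hs := IHs _ Hs.
case: s Ds s1 Hs {Hk} => [_ _ _|x s Ds s1 Hs].
  have -> : adj cancels (a :: [::] ++ b :: t) = (1 + adj cancels (b :: t))%N.
    by rewrite /= /cancels fb eqxx.
  have := adj_cat cancels [:: b] t; rewrite cat1s [adj _ [:: _]]/=.
  rewrite [size _]/=; move: (size t) (adj _ _) (adj _ _) Ht => *; nia.
have := adj_cat cancels [:: a] ((x :: s) ++ b :: t).
have := adj_cat cancels (x :: s) (b :: t).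
have := adj_cat cancels [:: b] t.
rewrite !cat1s ![adj _ [:: _]]/=; move: Hs.
set u := x :: s; rewrite [size (a :: _)]/= size_cat [size (b :: _)]/=.
move=> Hu H1 H2 H3.
have leN : (adj cancels u + adj cancels t <= adj cancels (a :: u ++ b :: t))%N by lia.
(* Without an innermost pair the induction bound would make [u] empty. With one, passing from [k.-1]
   to [k] gains at least 2, which pays for [a] and [b]. *)
have u_gt0 : (0 < adj cancels u)%N.
  by rewrite lt0n; apply/eqP => z; move: Hu; rewrite z muln0.
apply: leq_trans (_ : 2 * k * (adj cancels u + adj cancels t) <= _)%N; last first.
  by rewrite leq_mul2l leN orbT.
rewrite mulnDr; case: k k0 Hu Ht => // k _ Hu Ht.
have : (2 * k.+1 * adj cancels u = 2 * k * adj cancels u + 2 * adj cancels u)%N by lia.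
have : size u = (size s).+1 by [].
by move: Hu; rewrite [k.+1.-1]/=; lia.
Qed.

End Nesting.

(** * Paths in graphs over the rose *)

Section Paths.
Variables (n : nat) (G : rose_graph n).
Implicit Types (d e : dart G) (p q r : seq (dart G)) (u v w : vertex G).

Definition dart_label d : 'I_n * bool := (label d.1, d.2).

Lemma path_labelE p : path_label p = fg_of [seq dart_label d | d <- p].
Proof. by []. Qed.

Lemma dart_label_linv d : dart_label (linv d) = linv (dart_label d).
Proof. by []. Qed.

Lemma tail_linv d : tail (linv d) = head d.
Proof. by case: d => e []. Qed.

Lemma head_linv d : head (linv d) = tail d.
Proof. by case: d => e []. Qed.

Lemma path_label_cat p q : path_label (p ++ q) = path_label p * path_label q.
Proof. exact: lab_cat. Qed.

Lemma path_label_winv p : path_label (winv p) = (path_label p)^-1.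
Proof. by rewrite -fg_of_winv /path_label /winv map_rev -!map_comp. Qed.

Lemma is_path_winv u p v : is_path u p v -> is_path v (winv p) u.
Proof.
elim: p u => [|d p IH] u /=; first by move->.
move=> [<- /IH pv]; rewrite winv_cons -cats1; apply/is_path_cat.
by exists (head d) => //=; rewrite tail_linv head_linv.
Qed.

Lemma homotopic_path u v p q :
  homotopic u v p q -> is_path u p v /\ is_path u q v.
Proof. by elim=> // [? ? _ []|? ? ? _ [? ?] _ []]. Qed.

Lemma homotopic_cat w z r t u v p q :
    is_path w r u -> is_path v t z -> homotopic u v p q ->
  homotopic w z (r ++ p ++ t) (r ++ q ++ t).
Proof.
move=> wr vt; have cp p' : is_path u p' v -> is_path w (r ++ p' ++ t) z.
  by move=> up; apply/is_path_cat; exists u => //; apply/is_path_cat; exists v.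
elim=> [{}p /cp|{}p {}q _|{}p {}q s _ H1 _ H2|{}p d {}q H1 H2].
- exact: homotopic_refl.
- exact: homotopic_sym.
- exact: homotopic_trans H1 H2.
- have E1 : r ++ (p ++ [:: d; linv d] ++ q) ++ t = (r ++ p) ++ [:: d; linv d] ++ q ++ t.
    by rewrite -!catA.
  have E2 : r ++ (p ++ q) ++ t = (r ++ p) ++ q ++ t by rewrite -!catA.
  rewrite E1 E2; apply: homotopic_backtrack; rewrite -?E1 -?E2; exact: cp.
Qed.

Lemma homotopic_reduce u p v : is_path u p v -> homotopic u v p (reduce p).
Proof.
elim: p u => [|d p IH] u; first exact: homotopic_refl.
move=> [du /IH H].
have ud : is_path u [:: d] (head d) by split.
have /= dH := homotopic_cat ud (erefl v : is_path v [::] v) H.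
rewrite !cats0 in dH; apply: (homotopic_trans dH).
have [_ dr] := homotopic_path dH; move: dr; rewrite /= -/(reduce p).
case: (reduce p) => [|e r] dr /=; first exact: homotopic_refl.
case: eqP => [eE|_]; last exact: homotopic_refl.
move: dr; rewrite eE => dr.
apply: (@homotopic_backtrack _ _ _ _ [::] d r) => //=.
by case: dr => <- [_]; rewrite head_linv.
Qed.

Lemma is_path_reduce u p v : is_path u p v -> is_path u (reduce p) v.
Proof. by move/homotopic_reduce/homotopic_path => []. Qed.

Lemma path_label_reduce p : path_label (reduce p) = path_label p.
Proof.
elim: p => //= d p IH; rewrite [RHS]path_label_cons -IH.
case: (reduce p) => [|e r] /=; first by rewrite path_label_cons.
case: eqP => [->|_]; last by rewrite !path_label_cons.
by rewrite [in RHS]path_label_cons (fg_of_linv (dart_label d)) mulVKg.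
Qed.

(** Reduction only deletes darts, so it stays in a given set of edges and adds no crossings. *)
Lemma reduce_subseq p : subseq (reduce p) p.
Proof.
elim: p => //= d p IH; case: (reduce p) IH => [|e r] /= IH.
  by rewrite eqxx sub0seq.
case: eqP => [_|_] /=; last by rewrite eqxx.
apply: subseq_trans (subseq_trans IH (subseq_cons p d)).
exact: subseq_cons.
Qed.

Lemma is_path_junction u p d e q v : is_path u (p ++ d :: e :: q) v ->
  head d = tail e.
Proof. by move=> /is_path_cat[w _ [_ []]]. Qed.

End Paths.

(** * Graphs immersed in the rose *)

Section Immersed.
Variables (n : nat) (G : rose_graph n).
Implicit Types (p q : seq (dart G)) (u v w : vertex G).

Definition immersed := forall a b : dart G,
  tail a = tail b -> dart_label a = dart_label b -> a = b.

Hypothesis immG : immersed.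

Lemma immersed_path_inj u v w p q : is_path u p v -> is_path u q w ->
  [seq dart_label d | d <- p] = [seq dart_label d | d <- q] -> p = q.
Proof.
elim: p q u => [|a p IH] [|b q] u //= [au pv] [bu qw] [ab1 ab2 pq].
have ab : a = b by apply: immG; rewrite ?au // /dart_label ab1 ab2.
by congr (_ :: _) => //; apply: IH pq; [exact: pv|rewrite ab].
Qed.

(** By immersion, consecutive darts with cancelling labels form a backtrack. *)
Lemma immersed_reduced u p v : is_path u p v -> reduced p ->
  reduced [seq dart_label d | d <- p].
Proof.
elim: p u => //= a [|b p] IH u //= [au [ba pv]] /andP[nba rp].
apply/andP; split; last exact: (IH (head a)).
apply: contra nba => /eqP ab.
by apply/eqP/immG; rewrite ?tail_linv.
Qed.

Lemma immersed_fword u p v : is_path u p v -> reduced p ->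
  fword (path_label p) = [seq dart_label d | d <- p].
Proof. by move=> up rp; rewrite fwordK //; exact: immersed_reduced up rp. Qed.

Lemma immersed_reduced_inj u v w p q :
    is_path u p v -> is_path u q w -> reduced p -> reduced q ->
  path_label p = path_label q -> p = q.
Proof.
move=> up uq rp rq /(congr1 (@fword _)).
rewrite (immersed_fword up rp) (immersed_fword uq rq).
exact: immersed_path_inj up uq.
Qed.

End Immersed.

Lemma cov_immersed n (K : set (F n)) : immersed (cov K).
Proof.
move=> [[v i] []] [[w j] []] // tvw [ij]; rewrite ?ij in tvw *.
  by move: tvw; rewrite /tail /= => ->.
have [e [_ uniq_e]] := cov_in (dst ((v, j) : edge (cov K))) j.
congr (_, _); rewrite -(uniq_e (v, j)) //; apply: uniq_e; split=> //.
Qed.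

Section Core.
Variables (n : nat) (G : rose_graph n).
Implicit Types (p : seq (dart (core G))).

Definition core_vertex (u : vertex (core G)) : vertex G :=
  val (u : @core_vertices n G).

Definition core_dart (d : dart (core G)) : dart G :=
  (val (d.1 : @core_edges n G), d.2).

Lemma core_vertex_inj : injective core_vertex.
Proof. exact: val_inj. Qed.

Lemma core_dart_inj : injective core_dart.
Proof. by move=> [e b] [e' b'] [/val_inj -> ->]. Qed.

Lemma tail_core d : core_vertex (tail d) = tail (core_dart d).
Proof. by case: d => e []. Qed.

Lemma head_core d : core_vertex (head d) = head (core_dart d).
Proof. by case: d => e []. Qed.

Lemma is_path_core u p v :
  is_path u p v <-> is_path (core_vertex u) [seq core_dart d | d <- p] (core_vertex v).
Proof.
elim: p u => [|d p IH] u /=; first by split=> [->|/core_vertex_inj].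
rewrite -tail_core -head_core; split=> [[<- /IH]|[/core_vertex_inj <- /IH]] //.
Qed.

Lemma reduced_core p : reduced [seq core_dart d | d <- p] = reduced p.
Proof.
rewrite /reduced sorted_map; apply: eq_sorted => d e /=.
by rewrite -[linv (core_dart d)]/(core_dart (linv d)) (inj_eq core_dart_inj).
Qed.

Lemma path_label_core p : path_label [seq core_dart d | d <- p] = path_label p.
Proof. by rewrite /path_label -map_comp. Qed.

Lemma core_immersed : immersed G -> immersed (core G).
Proof.
move=> immG a b tab lab_ab; apply: core_dart_inj; apply: immG => //.
by rewrite -!tail_core tab.
Qed.

Lemma core_lift (q : seq (dart G)) : is_path (base G) q (base G) -> reduced q ->
  exists p, [seq core_dart d | d <- p] = q.
Proof.
move=> qP rq; have : forall d, d \in q -> @core_edges n G d.1.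
  move=> [e b] /splitPr qE; case: qE qP rq => q1 q2 qP rq.
  by exists q1, b, q2.
elim: q {qP rq} => [|[e b] q IH] H; first by exists [::].
have [p <-] := IH (fun d dq => H d (mem_behead (dq : d \in behead (_ :: q)))).
have /mem_set eP : @core_edges n G e by have := H (e, b) (mem_head _ _).
by exists ((set_elt eP, b) :: p).
Qed.

End Core.

Section Generated.
Variable G : groupType.
Implicit Types (S P : set G) (g x y : G).

Lemma subgroup1 P : subgroup P -> P 1.
Proof. by case=> /set_mem. Qed.

Lemma subgroupM P x y : subgroup P -> P x -> P y -> P (x * y).
Proof. by move=> /group_closedM/(_ x y); rewrite !inE; exact. Qed.

Lemma subgroupV P x : subgroup P -> P x -> P x^-1.
Proof. by move=> /group_closedV/(_ x); rewrite !inE; exact. Qed.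

Lemma subgroupP P : P 1 -> (forall x y, P x -> P y -> P (x * y^-1)) -> subgroup P.
Proof. by move=> P1 PD; split=> [|x y]; rewrite !inE //; exact: PD. Qed.

Lemma generated_subgroup S : subgroup (generated S).
Proof.
apply: subgroupP => [P [/subgroup1]//|x y Sx Sy P [sP SP]].
apply: subgroupM => //; first exact: Sx.
by apply: subgroupV => //; exact: Sy.
Qed.

Lemma generated_mem S x : S x -> generated S x.
Proof. exact: sub_gen_smallest. Qed.

Lemma generated_sub S P x :
  subgroup P -> (forall y, S y -> P y) -> generated S x -> P x.
Proof. by move=> sP SP; exact: smallest_sub. Qed.

Lemma generated_cyclic g x : generated [set g]%classic x ->
  exists k b, x = if b then g ^+ k else g ^- k.
Proof.
(* Products of this form are closed under quotients with no case distinction on signs. *)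
pose P : set G := fun x => exists i j, x = g ^+ i * g ^- j.
move=> gx; have : P x.
  apply: generated_sub gx => [|_ ->]; last first.
    by exists 1%N, 0%N; rewrite expg1 expg0 invg1 mulg1.
  apply: subgroupP => [|_ _ [i [j ->]] [k [l ->]]].
    by exists 0%N, 0%N; rewrite expg0 mulgV.
  exists (i + l)%N, (k + j)%N.
  rewrite invgM invgK !expgnDr invgM !mulgA; congr (_ * _).
  rewrite -!mulgA; congr (_ * _); apply/commute_sym/commuteV.
  by rewrite /commute -!expgnDr addnC.
move=> [i [j ->]]; have [ji|/ltnW ij] := leqP j i.
  by exists (i - j)%N, true; rewrite expgnFr.
by exists (j - i)%N, false; rewrite expgnFr // invgF.
Qed.

End Generated.

Section Crossings.
Variable A : choiceType.
Implicit Types (d : A * bool) (p : seq (A * bool)).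

Definition crossings d p := (count_mem d p + count_mem (linv d) p)%N.

Lemma count_linv_winv d p : count_mem (linv d) (winv p) = count_mem d p.
Proof.
rewrite count_rev count_map; apply: eq_count => e /=.
by rewrite (inj_eq (inv_inj (@linvK A))).
Qed.

Lemma crossings_cat d p q :
  crossings d (p ++ q) = (crossings d p + crossings d q)%N.
Proof. by rewrite /crossings !count_cat; lia. Qed.

Lemma crossings_winv d p : crossings d (winv p) = crossings d p.
Proof.
by rewrite /crossings count_linv_winv -{1}(linvK d) count_linv_winv addnC.
Qed.

(* Invariance of the signed number of crossings, without subtraction. *)
Lemma signed_crossings_reduce d p :
  (count_mem d (reduce p) + count_mem (linv d) p
   = count_mem d p + count_mem (linv d) (reduce p))%N.
Proof.
elim: p => //= e p; case: (reduce p) => [|e' r] /= IH; first by lia.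
case: eqP => [ee|_] /=; last by lia.
move: IH; rewrite ee (inv_eq (@linvK A)) (inj_eq (inv_inj (@linvK A))); lia.
Qed.

End Crossings.

(** * Loops in the cores of subgroups *)

Section CoreStar.
Variable n : nat.
Implicit Types (K : set (F n)) (k g : F n).

Lemma core_star_immersed K : immersed (core_star K).
Proof. exact/core_immersed/cov_immersed. Qed.

Lemma core_loop_exists K k : subgroup K -> K k ->
  exists p : seq (dart (core_star K)), core_loops k p /\ reduced p.
Proof.
move=> sK /(cov_pi1 k sK)[q [qP <-]].
have [p pq] := core_lift (is_path_reduce qP) (reduce_reduced q).
exists p; split; last by rewrite -reduced_core pq reduce_reduced.
split; last by rewrite -path_label_core pq path_label_reduce.
by apply/is_path_core; rewrite pq; exact: is_path_reduce.
Qed.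

Lemma core_loop_label K (p : seq (dart (core_star K))) : subgroup K ->
  is_path (base (core_star K)) p (base (core_star K)) -> K (path_label p).
Proof.
move=> sK /is_path_core pP; apply/(cov_pi1 _ sK).
by exists [seq core_dart d | d <- p]; rewrite path_label_core.
Qed.

(** The loops of the generators use finitely many edges, and every element of [K] labels a loop on
    these edges. A reduced loop is determined by its label, hence is the reduction of such a loop,
    and each edge of the core lies on a reduced loop. *)
Lemma core_star_finite K : finitely_generated K ->
  exists E : seq (edge (core_star K)), forall e, e \in E.
Proof.
move=> [s KE]; have sK : subgroup K by rewrite KE; exact: generated_subgroup.
pose b := base (core_star K).
pose P (E : seq (edge (core_star K))) : set (F n) := fun x =>
  exists p, [/\ is_path b p b, path_label p = x & forall d, d \in p -> d.1 \in E].
have [E EP] : exists E, forall x, x \in s -> P E x.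
  have : forall x, x \in s -> K x by move=> x xs; rewrite KE; exact: generated_mem.
  elim: s {KE} => [|x s IH] sub; first by exists [::].
  have [|E EP] := IH; first by move=> y ys; apply: sub; rewrite inE ys orbT.
  have [p [[pP px] _]] := core_loop_exists sK (sub x (mem_head _ _)).
  exists ([seq d.1 | d <- p] ++ E) => y; rewrite inE => /predU1P[->|/EP[q [qP qy qE]]].
    by exists p; split=> // d dp; rewrite mem_cat map_f.
  by exists q; split=> // d /qE dE; rewrite mem_cat dE orbT.
have sP : subgroup (P E).
  apply: subgroupP => [|x y [p [pP <- pE]] [q [qP <- qE]]]; first by exists [::].
  exists (p ++ winv q); split.
  - by apply/is_path_cat; exists b => //; exact: is_path_winv.
  - by rewrite path_label_cat path_label_winv.
  - move=> d; rewrite mem_cat => /orP[/pE//|].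
    by rewrite mem_winv => /qE.
exists E => e; have /set_mem[q1 [c [q2 [qP rq]]]] := valP (e : @core_edges n (cov K)).
have [p pq] := core_lift qP rq.
have pP : is_path b p b by apply/is_path_core; rewrite pq.
have rp : reduced p by rewrite -reduced_core pq.
have [p' [pP' pp' pE]] : P E (path_label p).
  by apply: (generated_sub sP EP); rewrite -KE; exact: core_loop_label.
have pE' : p = reduce p'.
  apply: (immersed_reduced_inj (@core_star_immersed K) pP (is_path_reduce pP')) => //.
    exact: reduce_reduced.
  by rewrite path_label_reduce pp'.
have : (e, c) \in p.
  by rewrite -(mem_map (@core_dart_inj _ _)) pq mem_cat mem_head orbT.
by rewrite pE' => /(mem_subseq (reduce_subseq _))/pE.
Qed.

(** The dart is the first one of the cyclic part of [g], written u(ac)u^-1. If its reverse occurred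
    in the loop, the prefix ending with it and the prefix reading [u] would reach the same vertex;
    their labels would differ by a power of [g], which [no_backward_prefix] excludes. *)
Lemma oneway_dart g (p : seq (dart (core_star (generated [set g]%classic)))) :
    g <> 1 -> core_loops g p -> reduced p ->
  exists d, d \in p /\ linv d \notin p.
Proof.
move=> g1 [pP pg] rp; set K := generated _ in p pP pg rp *.
have sK : subgroup K by exact: generated_subgroup.
have gw := immersed_fword (@core_star_immersed K) pP rp; rewrite pg in gw.
have [|u [a [c [uE rc]]]] := cyclic_decomposition (fword_reduced g).
  by move=> g0; apply: g1; rewrite -(fg_of_fword g) g0.
have pE : p = take (size u) p ++ drop (size u) p by rewrite cat_take_drop.
have tu : [seq dart_label d | d <- take (size u) p] = u.
  by rewrite map_take -gw uE take_size_cat.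
have := congr1 (drop (size u)) gw; rewrite uE drop_size_cat // -map_drop.
case: (drop _ p) pE => [|d q] // pE [ad _].
exists d; split; first by rewrite pE mem_cat mem_head orbT.
apply/negP => /splitPr pE'; move: pE pP gw tu; case: pE' => q1 q2 pE pP gw tu.
have [v uv [tv _]] : exists2 v,
    is_path (base (core_star K)) (take (size u) (q1 ++ linv d :: q2)) v &
    is_path v (d :: q) (base (core_star K)).
  by apply/is_path_cat; rewrite -pE.
have qv : is_path (base (core_star K)) (rcons q1 (linv d)) v.
  have : is_path (base (core_star K)) (rcons q1 (linv d) ++ q2) (base (core_star K)).
    by rewrite cat_rcons.
  move=> /is_path_cat[v' + _]; rewrite -cats1 => /is_path_cat[w q1w [ww v'w]].
  apply/is_path_cat; exists w => //; split=> //.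
  by rewrite head_linv.
have lK : K (path_label (rcons q1 (linv d) ++ winv (take (size u) (q1 ++ linv d :: q2)))).
  by apply: core_loop_label => //; apply/is_path_cat; exists v => //; exact: is_path_winv.
have [k [b kb]] := generated_cyclic lK.
apply: (@no_backward_prefix _ u a c [seq dart_label d | d <- q1]
  [seq dart_label d | d <- q2] k b) => //.
- by rewrite -uE; exact: fword_reduced.
- by rewrite -uE gw map_cat /= cat_rcons ad.
- rewrite -uE fg_of_fword -kb path_label_cat path_label_winv.
  rewrite [path_label (take _ _)]path_labelE tu mulgVK path_labelE map_rcons.
  by rewrite dart_label_linv ad.
Qed.

Lemma core_loop_power K g (k : nat) (b : bool) (q : seq (dart (core_star K))) :
    core_loops g q ->
  core_loops (if b then g ^+ k else g ^- k) (wpow (if b then q else winv q) k).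
Proof.
move=> [qP qg]; split.
  elim: k => //= m IH; apply/is_path_cat.
  by exists (base (core_star K)) => //; case: b {IH} => //; exact: is_path_winv.
elim: k => [|m IH]; first by case: b; rewrite expg0 ?invg1.
rewrite wpowS path_label_cat IH; case: b {IH}; rewrite ?path_label_winv qg ?expgS //.
by rewrite -[g * g ^+ m]expgS expgSr invgM.
Qed.

(* Since [d] is never crossed backwards by the loop q of g, the signed number    *)
(* of crossings of [d] by a loop of label g^k is k times that of q, up to sign.   *)
Lemma power_loop_crossings g (k : nat) (b : bool)
    (p q : seq (dart (core_star (generated [set g]%classic)))) d :
    core_loops g q -> linv d \notin q ->
    core_loops (if b then g ^+ k else g ^- k) p ->
  (k * count_mem d q <= crossings d p)%N.
Proof.
set K := generated _ in p q d *.
move=> [qP qg] dq [pP pg].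
have [q'P q'l] := core_loop_power k b (conj qP qg).
move: q'P q'l; set q' := wpow _ k => q'P q'l.
have := immersed_reduced_inj (@core_star_immersed K) (is_path_reduce pP)
  (is_path_reduce q'P) (reduce_reduced _) (reduce_reduced _).
rewrite !path_label_reduce q'l => /(_ pg) E.
have := signed_crossings_reduce d p; have := signed_crossings_reduce d q'.
rewrite -E /crossings.
have c0 : count_mem (linv d) q = 0%N by apply/count_memPn.
have cw a r : count_mem a (wpow r k) = (k * count_mem a r)%N.
  by elim: (k) => //= m IH; rewrite count_cat IH.
rewrite !cw; case: b {q' q'P q'l E pg} => /=; rewrite ?count_linv_winv.
  by rewrite c0; lia.
rewrite -[in count_mem d (winv q)](linvK d) count_linv_winv c0 muln0 => H1 H2.
by move: (k * _)%N (count_mem d (reduce p)) (count_mem d p) H1 H2 => x y z; lia.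
Qed.

End CoreStar.

(** * Equations and loops of the wedge *)

Section CyclicReduction.
Variables (n : nat) (H : set (F n)) (g : F n).
Hypothesis sH : subgroup H.
Implicit Types (s t : letter n) (v w : seq (letter n)).

Lemma phi_cons s w : phi g (s :: w) = eval_letter g s * phi g w.
Proof. exact: big_cons. Qed.

Lemma phi_nil : phi g [::] = 1.
Proof. exact: big_nil. Qed.

Lemma phi_cat v w : phi g (v ++ w) = phi g v * phi g w.
Proof.
by elim: v => [|s v IH]; rewrite ?phi_nil ?mul1g // cat_cons !phi_cons IH mulgA.
Qed.

Lemma phi_nseq k b :
  phi g (nseq k (inl b : letter n)) = if b then g ^+ k else g ^- k.
Proof.
case: b; elim: k => [|k IH]; rewrite ?phi_nil ?invg1 // phi_cons IH ?expgS //.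
by rewrite -[g * g ^+ k]expgS expgSr invgM.
Qed.

Lemma free_product_infix u v w :
  free_product H (u ++ v ++ w) -> free_product H v.
Proof.
move=> [Hh cw]; split=> [h hv|]; first by apply: Hh; rewrite !mem_cat hv orbT.
elim: u cw {Hh} => [|s u IH] /=; last by move/path_sorted.
by case: v => //= s v; rewrite cat_path => /andP[].
Qed.

(** A step conjugates, so the value under [phi] stays trivial. It never empties the word: end
    letters that cancel are incompatible, hence not adjacent in a reduced word. *)
Lemma cyclic_step_ideal w : ideal H g w -> w <> [::] ->
  ideal H g (cyclic_step w) /\ cyclic_step w <> [::].
Proof.
case: w => [|s [|t v]] // [fw pw] _; rewrite /=.
have E : s :: t :: v = [:: s] ++ belast t v ++ [:: last t v].
  by rewrite cats1 -lastI.
have fm : free_product H (belast t v).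
  by apply: (@free_product_infix [:: s] _ [:: last t v]); rewrite -E.
have pm : eval_letter g s * phi g (belast t v) * eval_letter g (last t v) = 1.
  by move: pw; rewrite E !phi_cat !phi_cons phi_nil !mulg1 mulgA.
have conj1 x y z : x * y * z = 1 :> F n -> z * x = 1 -> y = 1.
  by move=> xyz zx; apply: (mulgI x); rewrite mulg1; apply: (mulIg z);
    rewrite xyz; apply/esym; rewrite -(mulg1_eq zx) mulVg.
have mn : compatible s (last t v) = false -> belast t v <> [::].
  by case: v fw {E fm pm pw} => //= -[_ /= /andP[-> _]].
case: s E fw pw pm mn => [a|h] E fw pw pm mn;
  case El: (last t v) mn pm => [b|k] mn pm //=.
- case: eqP => // ab; split; last by apply: mn => /=; apply/eqP.
  split=> //; apply: conj1 pm _; case: a b ab {E fw pw mn El} => [] [] //= _.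
    exact: mulVg.
  exact: mulgV.
- case: eqP => [kh|kh]; first by split; [split=> //; exact: conj1 pm kh|exact: mn].
  split=> //; split; last first.
    by rewrite phi_cons /= -mulgA -[k in k * _](mulg1_eq pm) mulVg.
  have [Hh cw] := fw; split=> [x|].
    rewrite inE => /predU1P[[->]|xm]; last by case: fm => Hm _; exact: Hm.
    split; last by apply/eqP.
    apply: subgroupM => //; [have [] // := Hh k | have [] // := Hh h].
      by rewrite E El !mem_cat mem_head !orbT.
    by rewrite mem_head.
  move: cw; rewrite E; case: (belast t v) => //= x m /andP[cx].
  by rewrite cat_path => /andP[->]; case: (x) cx.
Qed.

Lemma cyclic_step_count w : (count (@is_x n) (cyclic_step w) <= count (@is_x n) w)%N.
Proof.
case: w => [|s [|t v]] //=.
have : (is_x t + count (@is_x n) v)%N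
    = (count (@is_x n) (belast t v) + is_x (last t v))%N.
  by rewrite -[LHS]/(count (@is_x n) (t :: v)) lastI -cats1 count_cat /= addn0.
by case: s => [a|h]; case: (last t v) => [b|k] /=; try case: ifP => _ /=; lia.
Qed.

(** Thus bounding the letters x of a word that need not be cyclically reduced suffices, and
    minimality gives equality. *)
Lemma degree_le w : (degree w <= count (@is_x n) w)%N.
Proof.
rewrite /degree /cyclic_reduction; elim: (size w) => //= m.
exact/leq_trans/cyclic_step_count.
Qed.

Lemma cyclic_reduction_ideal w : ideal H g w -> w <> [::] ->
  ideal H g (cyclic_reduction w) /\ cyclic_reduction w <> [::].
Proof.
move=> iw w0; rewrite /cyclic_reduction; elim: (size w) => //= m [im m0].
exact: cyclic_step_ideal.
Qed.

End CyclicReduction.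

(** * Paths in a wedge and their switches *)

Section WedgePaths.
Variables (n : nat) (G1 G2 : rose_graph n).
Local Notation W := (wedge G1 G2).
Implicit Types (d e : dart W) (p q : seq (dart W)).

Definition dartl (d : dart G1) : dart W := (inl d.1, d.2).
Definition dartr (d : dart G2) : dart W := (inr d.1, d.2).

Definition in_left d := if d.1 is inl _ then true else false.

Lemma wedge_inr_inj : injective (@wedge_inr n G1 G2).
Proof.
move=> u v; rewrite /wedge_inr.
case: insubP => [u' _ <-|/negPn/eqP->]; case: insubP => [v' _ <-|/negPn/eqP->] //=.
by move=> [->].
Qed.

Lemma wedge_inr_base : wedge_inr G1 (base G2) = base W.
Proof. by rewrite /wedge_inr insubF ?eqxx. Qed.

Lemma wedge_inr_inl v (u : vertex G1) :
  @wedge_inr n G1 G2 v = inl u -> wedge_inr G1 v = base W.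
Proof. by rewrite /wedge_inr; case: insubP. Qed.

Lemma tail_dartl (d : dart G1) : tail (dartl d) = inl (tail d).
Proof. by case: d => e []. Qed.
Lemma head_dartl (d : dart G1) : head (dartl d) = inl (head d).
Proof. by case: d => e []. Qed.
Lemma tail_dartr (d : dart G2) : tail (dartr d) = wedge_inr G1 (tail d).
Proof. by case: d => e []. Qed.
Lemma head_dartr (d : dart G2) : head (dartr d) = wedge_inr G1 (head d).
Proof. by case: d => e []. Qed.

Lemma dartl_inj : injective dartl.
Proof. by move=> [e b] [e' b'] [-> ->]. Qed.
Lemma dartr_inj : injective dartr.
Proof. by move=> [e b] [e' b'] [-> ->]. Qed.

Lemma dartlrP d : (exists a, d = dartl a) \/ (exists a, d = dartr a).
Proof. by case: d => [[e|e] b]; [left|right]; exists (e, b). Qed.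

Lemma is_path_wedgel u (p : seq (dart G1)) v :
  is_path u p v <-> is_path (inl u : vertex W) (wedge_pathl G2 p) (inl v).
Proof.
elim: p u => [|d p IH] u /=; first by split=> [->|[]].
rewrite -/(dartl d) tail_dartl head_dartl.
by split=> [[-> /IH]|[[->] /IH]].
Qed.

Lemma is_path_wedger u (p : seq (dart G2)) v : is_path u p v <->
  is_path (wedge_inr G1 u : vertex W) (wedge_pathr G1 p) (wedge_inr G1 v).
Proof.
elim: p u => [|d p IH] u /=; first by split=> [->|/wedge_inr_inj].
rewrite -/(dartr d) tail_dartr head_dartr.
by split=> [[-> /IH]|[/wedge_inr_inj-> /IH]].
Qed.

Lemma reduced_wedgel (p : seq (dart G1)) : reduced (wedge_pathl G2 p) = reduced p.
Proof.
rewrite /reduced sorted_map; apply: eq_sorted => d e /=.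
by rewrite -[linv _]/(dartl (linv d)) (inj_eq dartl_inj).
Qed.

Lemma reduced_wedger (p : seq (dart G2)) : reduced (wedge_pathr G1 p) = reduced p.
Proof.
rewrite /reduced sorted_map; apply: eq_sorted => d e /=.
by rewrite -[linv _]/(dartr (linv d)) (inj_eq dartr_inj).
Qed.

Lemma wedge_pathr_winv (p : seq (dart G2)) :
  wedge_pathr G1 (winv p) = winv (wedge_pathr G1 p).
Proof. by rewrite /wedge_pathr /winv map_rev -!map_comp. Qed.

Lemma path_label_wedgel (p : seq (dart G1)) :
  path_label (wedge_pathl G2 p) = path_label p.
Proof. by rewrite /path_label -map_comp. Qed.

Lemma path_label_wedger (p : seq (dart G2)) :
  path_label (wedge_pathr G1 p) = path_label p.
Proof. by rewrite /path_label -map_comp. Qed.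

Lemma homotopic_wedger u v (p q : seq (dart G2)) : homotopic u v p q ->
  homotopic (wedge_inr G1 u : vertex W) (wedge_inr G1 v)
    (wedge_pathr G1 p) (wedge_pathr G1 q).
Proof.
elim=> [{}p /is_path_wedger|{}p {}q _|{}p {}q r _ H1 _ H2|{}p d {}q].
- exact: homotopic_refl.
- exact: homotopic_sym.
- exact: homotopic_trans H1 H2.
move=> /is_path_wedger + /is_path_wedger; rewrite /wedge_pathr !map_cat /=.
exact: (@homotopic_backtrack _ W _ _ _ (dartr d)).
Qed.

Lemma crossings_wedgel (d : dart G2) (p : seq (dart G1)) :
  crossings (dartr d) (wedge_pathl G2 p) = 0%N.
Proof. by rewrite /crossings !(count_memPn _) //; apply/negP => /mapP[]. Qed.

Lemma crossings_wedger (d : dart G2) (p : seq (dart G2)) :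
  crossings (dartr d) (wedge_pathr G1 p) = crossings d p.
Proof.
by rewrite /crossings /wedge_pathr !count_map; congr (_ + _)%N.
Qed.

Lemma left_path p : all in_left p ->
  exists q1 : seq (dart G1), p = wedge_pathl G2 q1.
Proof.
elim: p => [|[[e|e] b] p IH] //=; first by exists [::].
by move=> /IH[q ->]; exists ((e, b) :: q).
Qed.

Lemma right_path p : all (predC in_left) p ->
  exists q2 : seq (dart G2), p = wedge_pathr G1 q2.
Proof.
elim: p => [|[[e|e] b] p IH] //=; first by exists [::].
by move=> /IH[q ->]; exists ((e, b) :: q).
Qed.

Lemma switch_base d e : head d = tail e -> in_left d != in_left e ->
  head d = base W.
Proof.
case: (dartlrP d) => [] [a ->]; case: (dartlrP e) => [] [b ->] //.
  by rewrite head_dartl tail_dartr => E _; rewrite E; apply: wedge_inr_inl (esym E).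
by rewrite head_dartr tail_dartl => /wedge_inr_inl ->.
Qed.

(** This locates the innermost matched pairs of a reduced loop: inside one part they would be
    backtracks, so they sit at switches. *)
Lemma wedge_cancel d e : immersed G1 -> immersed G2 ->
    head d = tail e -> dart_label e = linv (dart_label d) ->
  in_left d = in_left e -> e = linv d.
Proof.
move=> i1 i2; case: (dartlrP d) => [] [a ->]; case: (dartlrP e) => [] [b ->] //.
  rewrite head_dartl tail_dartl => -[ab] l _; suff -> : b = linv a by [].
  by apply: i1; rewrite ?tail_linv.
rewrite head_dartr tail_dartr => /wedge_inr_inj ab l _; suff -> : b = linv a by [].
by apply: i2; rewrite ?tail_linv.
Qed.

Definition switches : rel (dart W) := fun d e => in_left d != in_left e.

Lemma split_side b p : exists q r, [/\ p = q ++ r, all (fun d => in_left d == b) q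
  & if r is d :: _ then in_left d = ~~ b else True].
Proof.
elim: p => [|d p [q [r [pE qb rb]]]]; first by exists [::], [::].
have [db|db] := eqVneq (in_left d) b.
  by exists (d :: q), r; rewrite pE /= db eqxx.
by exists [::], (d :: p); split=> //; case: (in_left d) b db {qb rb} => [] [].
Qed.

Lemma adj_switches b p q : all (fun d => in_left d == b) p ->
  (adj switches (p ++ q) <= adj switches q + (q != [::]))%N.
Proof.
elim: p => [|d p IH] /=; first by move=> _; lia.
move=> /andP[/eqP db pb]; have := IH pb; case: p pb {IH} => [|e p] /=.
  by case: q => //= e q _ _; case: (switches d e) => /=; lia.
move=> /andP[/eqP eb _]; suff -> : switches d e = false by [].
by rewrite /switches db eb eqxx.
Qed.

End WedgePaths.

(** * Cutting out what lies between two equal pairs *)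

Lemma excise_path n (G : rose_graph n) (u v : vertex G) X a Y Z U b V :
  is_path u (X ++ a :: (Y ++ a :: Z ++ b :: U) ++ b :: V) v ->
  is_path u (X ++ a :: Z ++ b :: V) v.
Proof.
move=> /is_path_cat[x Xx [ax /is_path_cat[y + [yb bV]]]].
move=> /is_path_cat[z _ [az /is_path_cat[t Zt [tb _]]]].
apply/is_path_cat; exists x => //; split=> //; apply/is_path_cat; exists t => //.
Qed.

(** The pieces Xa, aZb and bV all occur in the original word because the two pairs are equal, and
    they overlap in one letter. *)
Lemma excise_reduced (A : choiceType) (X Y Z U V : seq (A * bool)) a b :
  reduced (X ++ a :: (Y ++ a :: Z ++ b :: U) ++ b :: V) ->
  reduced (X ++ a :: Z ++ b :: V).
Proof.
move=> r.
have r1 : reduced (X ++ [:: a]).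
  by apply: (@reduced_catl _ _ ((Y ++ a :: Z ++ b :: U) ++ b :: V)); rewrite -catA.
have r2 : reduced ((a :: Z) ++ [:: b]).
  apply: (@reduced_catr _ (X ++ a :: Y)); apply: (@reduced_catl _ _ (U ++ b :: V)).
  by move: r; do 3! rewrite -?catA /=.
have r3 : reduced ([:: b] ++ V).
  apply: (@reduced_catr _ (X ++ a :: (Y ++ a :: Z ++ b :: U))).
  by rewrite -catA.
have r4 : reduced ((a :: Z) ++ [:: b] ++ V) by exact: reduced_glue.
exact: (@reduced_glue _ X [:: a] (Z ++ b :: V)).
Qed.

Lemma excise_crossings (A : choiceType) (X Y Z U V : seq (A * bool)) a b d :
  (crossings d (X ++ a :: Z ++ b :: V)
   <= crossings d (X ++ a :: (Y ++ a :: Z ++ b :: U) ++ b :: V))%N.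
Proof.
rewrite /crossings; do 3! rewrite ?count_cat /=.
lia.
Qed.

Lemma immersed_homotopic n (G : rose_graph n) (u v : vertex G) p q :
    immersed G -> is_path u p v -> is_path u q v ->
  path_label p = path_label q -> homotopic u v p q.
Proof.
move=> immG up uq pq; apply: homotopic_trans (homotopic_reduce up) _.
suff -> : reduce p = reduce q by exact/homotopic_sym/homotopic_reduce.
apply: (immersed_reduced_inj immG (is_path_reduce up) (is_path_reduce uq));
  rewrite ?path_label_reduce //; exact: reduce_reduced.
Qed.

Lemma immersed_reduced_neq1 n (G : rose_graph n) (u v : vertex G) p :
    immersed G -> is_path u p v -> reduced p -> p <> [::] -> path_label p <> 1.
Proof.
move=> immG up rp p0 /(congr1 (@fword _)).
by rewrite (immersed_fword immG up rp); case: p p0 {up rp}.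
Qed.

(** * Passing between equations and loops *)

Section Theta.
Variables (n : nat) (H : set (F n)) (g : F n).
Implicit Types (v w : seq (letter n)).
Local Notation W := (core_wedge H g).
Local Notation star := (base W).
Implicit Types (p q : seq (dart W)).

Lemma letter_loops_path s p : @letter_loops n H g s p -> is_path star p star.
Proof.
case: s => [[]|h] [q [qP _] <-]; last exact: (is_path_wedgel _ _ _ _).1 qP.
  by rewrite -wedge_inr_base; exact: (is_path_wedger _ _ _ _).1 qP.
by apply: is_path_winv; rewrite -wedge_inr_base; exact: (is_path_wedger _ _ _ _).1 qP.
Qed.

Lemma theta_path w p : theta (H := H) (g := g) w p -> is_path star p star.
Proof. by case: w => [/homotopic_path[]|s w [q [r [_ _ /homotopic_path[]]]]]. Qed.

Lemma theta_homotopic w p q :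
  theta (H := H) (g := g) w p -> homotopic star star p q -> theta w q.
Proof.
case: w => [|s w] /=; first by move=> H1 H2; exact: homotopic_trans H1 H2.
by move=> [r [t [rs tw rt]]] pq; exists r, t; split=> //; exact: homotopic_trans rt pq.
Qed.

Lemma theta_cat v w p q :
  theta (H := H) (g := g) v p -> theta w q -> theta (v ++ w) (p ++ q).
Proof.
move=> vp wq; have qP := theta_path wq.
elim: v p vp => [|s v IH] p /=.
  move=> h; apply: theta_homotopic wq _.
  by have := homotopic_cat (erefl : is_path star [::] star) qP h.
move=> [r [t [rs tv rt]]]; exists r, (t ++ q); split=> //; first exact: IH.
by rewrite catA; have := homotopic_cat (erefl : is_path star [::] star) qP rt.
Qed.

Lemma theta_letter s p : @letter_loops n H g s p -> theta (H := H) (g := g) [:: s] p.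
Proof.
move=> sp; exists p, [::]; split=> //=; first exact: homotopic_refl.
by rewrite cats0; apply: homotopic_refl; exact: letter_loops_path sp.
Qed.

Lemma theta_nseq s k p : @letter_loops n H g s p ->
  theta (H := H) (g := g) (nseq k s) (wpow p k).
Proof.
move=> sp; elim: k => [|k IH]; first exact: homotopic_refl.
exact: (theta_cat (theta_letter sp) IH).
Qed.

Section Correspondence.
Hypothesis sH : subgroup H.
Variables (gamma : seq (dart (core_star (generated [set g]%classic))))
          (d : dart (core_star (generated [set g]%classic))).
Hypotheses (gamma_g : core_loops g gamma)
           (d_oneway : linv d \notin gamma).

Let sK : subgroup (generated [set g]%classic) := @generated_subgroup _ _.
Let D : dart W := dartr (core_star H) d.

(** Only the copies of [gamma] and its inverse, one per letter x, cross [D]. *)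
Lemma word_path w : (forall h, inr h \in w -> H h) -> exists p,
  [/\ theta w p, path_label p = phi g w
    & (crossings D p <= count_mem d gamma * count (@is_x n) w)%N].
Proof.
have c0 : crossings d gamma = count_mem d gamma.
  by rewrite /crossings (count_memPn d_oneway) addn0.
elim: w => [|s w IH] Hw.
  by exists [::]; split=> //; [exact: homotopic_refl|rewrite phi_nil; exact: val_inj].
have [|q [wq ql qc]] := IH; first by move=> h hw; apply: Hw; rewrite inE hw orbT.
have [p [sp pl pc]] : exists p,
  [/\ @letter_loops n H g s p, path_label p = eval_letter g s
    & (crossings D p <= count_mem d gamma * is_x s)%N].
  have [gP gl] := gamma_g.
  case: s Hw => [[]|h] Hw.
  - exists (wedge_pathr _ gamma); split; first by exists gamma.
      by rewrite path_label_wedger.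
    by rewrite crossings_wedger c0 muln1.
  - exists (winv (wedge_pathr _ gamma)); split; first by exists gamma.
      by rewrite path_label_winv path_label_wedger gl.
    by rewrite crossings_winv crossings_wedger c0 muln1.
  - have [p [[pP pl] _]] := core_loop_exists sH (Hw h (mem_head _ _)).
    exists (wedge_pathl _ p); split; first by exists p.
      by rewrite path_label_wedgel.
    by rewrite crossings_wedgel.
exists (p ++ q); split; first exact: (theta_cat (theta_letter sp) wq).
  by rewrite path_label_cat phi_cons pl ql.
rewrite crossings_cat [count (@is_x n) (s :: w)]/= mulnDr.
exact: leq_add.
Qed.

(* A reduced loop is cut at its switches between the two parts of the wedge.     *)
Lemma path_word p : is_path star p star -> reduced p -> exists w,
  [/\ free_product H w, theta w p, phi g w = path_label p,
      (count_mem d gamma * count (@is_x n) w <= crossings D p)%N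
    & match p, w with
      | [::], [::] => True
      | e :: _, s :: _ => is_x s = ~~ in_left e
         /\ (adj (@switches _ _ _) p + ~~ in_left e <= 2 * count (@is_x n) w)%N
      | _, _ => False
      end].
Proof.
have [m] := ubnP (size p); elim: m p => // m IH [|e p] sz.
  move=> _ _; exists [::]; split=> //; first exact: homotopic_refl.
    by rewrite phi_nil; exact: val_inj.
  by rewrite muln0.
have [q [r [pE qe re]]] := split_side (in_left e) p.
rewrite pE -cat_cons => /is_path_cat[x ex xr] rp.
(* A non-empty rest starts in the other part, which is possible only at the base point; otherwise
   the segment ends with the loop. *)
have xs : x = star.
  case: r re xr {pE rp} => [|d' r] // rd [dx _]; move: ex; rewrite lastI -cats1.
  case/is_path_cat => y _ [_ /= lx]; rewrite -lx.
  apply: (@switch_base _ _ _ _ d'); first by rewrite lx.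
  have : last e q \in e :: q by exact: mem_last.
  rewrite inE => /predU1P[->|/(allP qe)/eqP->]; by rewrite rd; case: (in_left e).
subst x.
have rr := reduced_catr rp; have re' := reduced_catl rp.
have [|w [fw tw pw cw hw]] := IH r _ xr rr.
  by move: sz; rewrite pE /= size_cat; lia.
have qe' : all (fun d' => in_left d' == in_left e) (e :: q) by rewrite /= eqxx.
have adjE := adj_switches r qe'.
(* A left segment becomes one letter of [H]. It brings no letter x; its switch is paid for by the
   summand [~~ in_left e] in the bound for the rest. *)
case eL: (in_left e) qe' re => qe' re.
  have [|q1 q1E] := @left_path _ _ _ (e :: q).
    by apply: sub_all qe' => d' /eqP.
  rewrite q1E in ex re'.
  have q1P : is_path (base (core_star H)) q1 (base (core_star H)).
    exact: (is_path_wedgel (core_star (generated [set g]%classic)) _ _ _).2 ex.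
  have rq1 : reduced q1.
    by rewrite -(reduced_wedgel (core_star (generated [set g]%classic))).
  have q1l : path_label q1 <> 1.
    apply: (immersed_reduced_neq1 (@core_star_immersed n H) q1P rq1).
    by move=> q10; rewrite q10 in q1E.
  exists (inr (path_label q1) :: w); split.
  - have [Hw sw] := fw; split.
      move=> h; rewrite inE => /predU1P[[->]|/Hw//].
      by split; [exact: core_loop_label|exact/eqP].
    move: re hw sw; case: (r) => [|d' r'] /=; first by case: (w).
    by move=> ->; case: (w) => // -[] //= ? ? [].
  - by rewrite q1E; apply: (theta_cat (theta_letter (s := inr _) _) tw); exists q1.
  - by rewrite q1E phi_cons pw path_label_cat path_label_wedgel.
  - by rewrite q1E crossings_cat crossings_wedgel; exact: cw.
  - split=> //; rewrite addn0; apply: leq_trans adjE _.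
    rewrite [count _ (_ :: _)]/= add0n.
    by move: re hw; case: (r) => [|d' r'] //= ->; case: (w) => // s w' [_].
have [|q1 q1E] := @right_path _ _ _ (e :: q).
  by apply: sub_all qe' => d' /eqP /= ->.
rewrite q1E in ex re'.
have q1P : is_path (base (core_star (generated [set g]%classic))) q1 (base _).
  by apply: (is_path_wedger (core_star H) _ _ _).2; rewrite wedge_inr_base.
have rq1 : reduced q1 by rewrite -(reduced_wedger (core_star H)).
have q1l : path_label q1 <> 1.
  apply: (immersed_reduced_neq1 (@core_star_immersed n _) q1P rq1).
  by move=> q10; rewrite q10 in q1E.
(* A right segment becomes [k > 0] letters x of one sign, which pay for the at most two switches at
   its ends. *)
have [k [b kb]] := generated_cyclic (core_loop_label sK q1P).
have k0 : (0 < k)%N.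
  by case: k kb => // kb; case: q1l; rewrite kb expg0 invg1; case: (b).
have [q'P q'l] := core_loop_power k b gamma_g.
exists (nseq k (inl b) ++ w); split.
- have [Hw sw] := fw; split.
    by move=> h; rewrite mem_cat mem_nseq andbF /=; exact: Hw.
  elim: k k0 {kb q'P q'l} => // -[|k] IHk _ /=; last by rewrite eqxx; exact: (IHk isT).
  move: re hw sw; case: (r) => [|d' r'] /=; first by case: (w).
  by move=> ->; case: (w) => // -[] //= ? ? [].
- rewrite q1E; apply: (theta_cat _ tw).
  apply: (theta_homotopic (@theta_nseq (inl b) k
     (if b then wedge_pathr _ gamma else winv (wedge_pathr _ gamma)) _)).
    by case: (b); exists gamma.
  rewrite -wedge_inr_base.
  have -> : wpow (if b then wedge_pathr (core_star H) gamma
      else winv (wedge_pathr (core_star H) gamma)) k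
    = wedge_pathr (core_star H) (wpow (if b then gamma else winv gamma) k).
    rewrite [RHS]map_wpow; case: (b) => //.
    by congr wpow; exact/esym/wedge_pathr_winv.
  apply: homotopic_wedger; apply: immersed_homotopic => //.
    exact: core_star_immersed.
  by rewrite q'l kb.
- by rewrite q1E phi_cat pw path_label_cat path_label_wedger kb phi_nseq.
- rewrite q1E count_cat count_nseq crossings_cat crossings_wedger mulnDr leq_add //.
  rewrite /= mul1n mulnC; apply: (power_loop_crossings gamma_g d_oneway).
  by split=> //; exact: kb.
- case: k k0 {kb q'P q'l} => // k _; split=> //; rewrite addn1.
  rewrite count_cat count_nseq mul1n mulnDr; apply: leq_ltn_trans adjE _.
  by move: re hw; case: (r) => [|d' r'] /=; [|case: (w) => // s w' -> []]; lia.
Qed.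


End Correspondence.
End Theta.

(** * Counting matched pairs and shortening the loop *)

Lemma wedge_edges n (H : set (F n)) g : finitely_generated H ->
  exists E : seq (edge (core_wedge H g)),
    size E = num_edges (core_wedge H g) /\ forall e, e \in E.
Proof.
move=> fgH; have [E1 E1P] := core_star_finite fgH.
have [|E2 E2P] := @core_star_finite _ (generated [set g]%classic).
  by exists [:: g]; congr generated; apply/seteqP; split=> x /=; rewrite ?inE => /eqP.
have fin : finite_set [set: edge (core_wedge H g)]%classic.
  apply/finite_seqP; exists (map inl E1 ++ map inr E2 : seq (edge (core_wedge H g))).
  apply/seteqP; split=> // -[e|e] _ /=; rewrite mem_cat; apply/orP.
    by left; apply/mapP; exists e.
  by right; apply/mapP; exists e.
exists (enum_fset (fset_set [set: edge (core_wedge H g)]%classic)); split=> // e.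
by have := in_fset_set fin e; rewrite in_setT.
Qed.

(** Matched darts have opposite signs, so a pair amounts to two edges and one sign. *)
Lemma nest_size_uniq n (G : rose_graph n) (E : seq (edge G)) C (s : seq (dart G)) :
    (forall e, e \in E) -> nest (@dart_label n G) C s -> uniq C ->
  (size C <= 2 * size E ^ 2)%N.
Proof.
move=> EP Cs uC.
pose c (x : edge G * edge G * bool) := ((x.1.1, x.2), (x.1.2, ~~ x.2)).
pose S := [seq c x | x <- allpairs pair (allpairs pair E E) [:: true; false]].
have -> : (2 * size E ^ 2 = size S)%N.
  by rewrite size_map !size_allpairs /= mulnC -mulnn.
apply: uniq_leq_size => // -[[e a] [f b]] /(nest_matched Cs) [_ ->].
apply/mapP; exists (e, f, a) => //; apply: allpairs_f; first exact: allpairs_f.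
by case: a.
Qed.

Theorem theorem4p3 (n : nat) (H : set (F n)) (g : F n) (dmin : nat)
  (H_subgroup : subgroup H) (H_fg : finitely_generated H)
  (g_neq1 : g <> 1) (g_dep : depends_on H g)
  (dminP : is_min_degree H g dmin) :
  exists (w : seq (letter n)) (sigma : seq (dart (core_wedge H g))),
    [/\ ideal H g w, w <> [::], degree w = dmin,
        corresponding_path w sigma
      & (size sigma <= 16 * num_edges (core_wedge H g) ^ 2 * dmin)%N].
Proof.
have [[w1 [iw1 w1_neq0 dw1]] min_d] := dminP.
have [iw0 w0_neq0] := cyclic_reduction_ideal H_subgroup iw1 w1_neq0.
pose K := generated [set g]%classic.
have sK : subgroup K by exact: generated_subgroup.
have Kg : K g by exact: generated_mem.
have [gamma [gamma_g rgamma]] := core_loop_exists sK Kg.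
have [d [d_in d_oneway]] := oneway_dart g_neq1 gamma_g rgamma.
pose c := count_mem d gamma; have c_gt0 : (0 < c)%N by rewrite -has_count has_pred1.
have [E [EL EP]] := wedge_edges g H_fg; rewrite -EL.
pose W := core_wedge H g; pose D : dart W := dartr (core_star H) d.
(* The crossing bound is what excision visibly preserves; the equation is recomputed from it by
   [path_word]. *)
pose good (p : seq (dart W)) := [/\ is_path (base W) p (base W), reduced p,
  path_label p = 1, (crossings D p <= c * dmin)%N &
  exists w, [/\ ideal H g w, w <> [::], theta w p & (count (@is_x n) w <= dmin)%N]].
(* Starting from a cyclic reduction makes the number of letters x equal to the degree. *)
have [p0 good0] : exists p, good p.
  have [|p [wp pl pc]] := @word_path n H g H_subgroup gamma d gamma_g d_oneway
    (cyclic_reduction w1).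
    by move=> h hw; have [[/(_ h hw)[]]] := iw0.
  have pP := theta_path wp.
  have cw0 : count (@is_x n) (cyclic_reduction w1) = dmin by [].
  exists (reduce p); split.
  - exact: is_path_reduce.
  - exact: reduce_reduced.
  - by rewrite path_label_reduce pl; case: iw0.
  - apply: leq_trans (leq_trans pc _); last by rewrite cw0.
    by apply: leq_add; apply: leq_count_subseq; exact: reduce_subseq.
  - exists (cyclic_reduction w1); split=> //; last by rewrite cw0.
    exact: theta_homotopic wp (homotopic_reduce pP).
suff [p [good_p p_size]] : exists p, good p /\ (size p <= 16 * size E ^ 2 * dmin)%N.
  have [_ rp _ _ [w [iw w_neq0 wp cw]]] := good_p.
  exists w, p; split=> //; apply/eqP; rewrite eqn_leq min_d // andbT.
  exact: leq_trans (degree_le w) cw.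
have [m] := ubnP (size p0); elim: m p0 good0 => // m IH p good_p p_lt.
have [pP rp pl pc _] := good_p.
(* Either a long chain allows a cut, or the loop is already short enough. *)
have [[C [Cp C_gt]]|noC] :=
  pselect (exists C, nest (@dart_label n W) C p /\ (2 * size E ^ 2 < size C)%N).
  have [|X [a [Y [Z [U [b [V [pE fab YU Z1]]]]]]]] := nest_dup Cp.
    by apply/negP => /(nest_size_uniq EP Cp); rewrite leqNgt C_gt.
  rewrite pE in pP rp; set q := X ++ a :: Z ++ b :: V.
  have qP : is_path (base W) q (base W) by exact: excise_path pP.
  have rq : reduced q by exact: excise_reduced rp.
  have ql : path_label q = 1.
    rewrite -pl pE !path_label_cat; congr (_ * _).
    rewrite !path_labelE (lab_pair _ fab Z1) (lab_pair _ fab) //.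
    by rewrite lab_cat (lab_pair _ fab Z1) -lab_cat.
  have qc : (crossings D q <= crossings D p)%N.
    by rewrite pE; exact: excise_crossings.
  have [w [fw wq wl wc hw]] := path_word H_subgroup gamma_g d_oneway qP rq.
  apply: (IH q); last first.
    by move: p_lt; rewrite pE /q !size_cat /= !size_cat /= !size_cat /=; lia.
  split=> //; first exact: leq_trans qc pc.
  exists w; split=> //; first by split=> //; rewrite wl.
    by move=> w0; move: hw; rewrite w0 /q; case: (X).
  (* Cancelling [c] turns the crossing bound into one on letters x. *)
  rewrite -(leq_pmul2l c_gt0); apply: leq_trans wc _; exact: leq_trans qc pc.
exists p; split=> //.
have [w [_ _ _ wc hw]] := path_word H_subgroup gamma_g d_oneway pP rp.
have cw : (count (@is_x n) w <= dmin)%N.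
  by rewrite -(leq_pmul2l c_gt0); exact: leq_trans wc pc.
have sw : (adj (@switches _ _ _) p <= 2 * dmin)%N.
  by case: (p) hw => // e p' hw; case: (w) hw cw => // s w' [_]; lia.
have cancels_switches : (adj (cancels (@dart_label n W)) p <= adj (@switches _ _ _) p)%N.
  apply: adj_le => X a b V pE /eqP ab; apply/negP => /eqP side_ab.
  have ne : b != linv a.
    by move: rp; rewrite pE reduced_catP => /and3P[].
  move: pP; rewrite pE => /is_path_junction hd.
  by move: ne; rewrite (wedge_cancel _ _ hd ab) ?eqxx //; exact: core_star_immersed.
have nest_le C : nest (@dart_label n W) C p -> (size C <= 2 * size E ^ 2)%N.
  by move=> Cp; rewrite leqNgt; apply/negP => C_gt; apply: noC; exists C.
have := dyck_size (lab1_dyck pl) nest_le.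
move/leq_trans; apply.
apply: leq_trans (leq_mul (leqnn _) (leq_trans cancels_switches sw)) _.
(* The constant obtained is 2 * 2 * 2 = 8, within the allowed 16. *)
by rewrite !mulnA; apply: leq_mul => //; lia.
Qed.
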